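(* There exist $\lambda>1$ and a separable Banach space $X$ such that no retraction from $X$ onto any generating compact and convex subset of $X$ is $\lambda$-Lipschitz. That is, for every compact convex set $K\subset X$ whose closed linear span is $X$, there is no map $R:X\to K$ with $R(x)=x$ for all $x\in K$ and $\|R(x)-R(y)\|\le\lambda\|x-y\|$ for all $x,y\in X$.
   Context: Banach spaces are over $\mathbb{R}$. A subset $S$ of a Banach space $X$ is generating if the closed linear span of $S$ is $X$. A retraction from a metric space $M$ onto a subset $N\subset M$ is a map $R:M\to N$ with $R(x)=x$ for every $x\in N$. A map $f$ between metric spaces is $\lambda$-Lipschitz if $d(f(x),f(y))\le\lambda d(x,y)$ for all $x,y$. *)

(* Defs.v *)
From mathcomp Require Import all_boot all_order all_algebra.
From mathcomp Require Import all_classical all_reals all_analysis.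

Set Implicit Arguments.
Unset Strict Implicit.
Unset Printing Implicit Defensive.

Import Order.TTheory GRing.Theory Num.Theory.
Import numFieldNormedType.Exports.

Local Open Scope classical_set_scope.
Local Open Scope ring_scope.

Definition separable_space (T : topologicalType) : Prop :=
  exists2 D : set T, countable D & dense D.

Definition linear_span (R : realType) (V : lmodType R) (S : set V) : set V :=
  [set x | exists (n : nat) (a : 'I_n -> R) (v : 'I_n -> V),
    (forall i, S (v i)) /\ x = \sum_(i < n) a i *: v i].

Definition closed_linear_span (R : realType) (X : normedModType R)
    (S : set X) : set X := closure (linear_span S).

Definition generating (R : realType) (X : normedModType R) (S : set X) : Prop :=
  closed_linear_span S = [set: X].

(* A map onto the subset N is encoded as a self-map of M with values in N. *)
Definition retraction_onto (M : Type) (N : set M) (r : M -> M) : Prop :=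
  (forall x, N (r x)) /\ (forall x, N x -> r x = x).

(* Main.v *)
Require Import Defs.
From HB Require Import structures.
From mathcomp Require Import all_boot all_order all_algebra.
From mathcomp Require Import all_classical all_reals all_analysis.
From mathcomp Require Import ring lra.

Set Implicit Arguments.
Unset Strict Implicit.
Unset Printing Implicit Defensive.

Import Order.TTheory GRing.Theory Num.Theory.
Import numFieldNormedType.Exports.

Local Open Scope classical_set_scope.
Local Open Scope ring_scope.

(** The space is [R^3] with a polyhedral norm [N] for which no plane is the
    range of a projection of norm close to 1; a Lipschitz retraction with a
    constant close to 1 would produce such a projection.

    Let [K] be convex, spanning and not the whole space.  Either [K] has
    interior, and at the point [x] where a maximal inscribed Euclidean ball
    touches its boundary it looks like a half-space [f >= f x]; or [K] lies in a
    plane [f = 1] and fills it near some point [x].  This is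
    [spanning_smooth_support].

    Take [p] slightly below [x], with [f p = f x - t], and let [t u] be the
    displacement of [p] by a [lambda]-Lipschitz retraction [r].  Since [r p] is
    in [K], one has [f u >= 1].  If [N e = 1] and [f e > 0], the ray from [p] in
    the direction [e] meets [K] at a point [p + s e] with [s] of the order of
    [t / f e], which [r] fixes.  Hence [N (s e - t u) <= lambda s], and a
    functional [g <= N] with [g e = 1] satisfies [g u >= - (lambda - 1) s / t].
    This is [retraction_almost_contractive].

    If the kernel of [f] cuts the facet [g = 1] of the unit ball, applying this
    to vertices of the facet on both sides shows that [g u] is of the order of
    [lambda - 1].  So [u] is small, contradicting [f u >= 1], as soon as every
    plane through the origin cuts three facets with independent normals.  The
    maximum of [|x - 2z|], [|y - 2x|], [|z - 2y|], [|3x + y|], [|3y + z|],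
    [|3z + x|] and [3 |x + y + z|] is a norm with this property
    ([three_facets_crossed]), with a margin that allows [lambda = 1 + 1/4000]. *)

(** * The dot product and the maximum norm on row vectors *)

Definition dot (R : comNzRingType) (n : nat) (x y : 'rV[R]_n) : R :=
  \sum_i x 0 i * y 0 i.

Section Dot.
Context {R : comNzRingType} {n : nat}.
Implicit Types (x y z : 'rV[R]_n) (a : R).

Lemma dotC x y : dot x y = dot y x.
Proof. by apply: eq_bigr => i _; rewrite mulrC. Qed.

Lemma dotDr x y z : dot x (y + z) = dot x y + dot x z.
Proof. by rewrite -big_split/=; apply: eq_bigr => i _; rewrite mxE mulrDr. Qed.

Lemma dotZr a x y : dot x (a *: y) = a * dot x y.
Proof. by rewrite mulr_sumr; apply: eq_bigr => i _; rewrite mxE mulrCA. Qed.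

Lemma dotNr x y : dot x (- y) = - dot x y.
Proof. by rewrite -scaleN1r dotZr mulN1r. Qed.

Lemma dotBr x y z : dot x (y - z) = dot x y - dot x z.
Proof. by rewrite dotDr dotNr. Qed.

Lemma dotDl x y z : dot (x + y) z = dot x z + dot y z.
Proof. by rewrite !(dotC _ z) dotDr. Qed.

Lemma dotZl a x y : dot (a *: x) y = a * dot x y.
Proof. by rewrite !(dotC _ y) dotZr. Qed.

Lemma dotNl x y : dot (- x) y = - dot x y.
Proof. by rewrite !(dotC _ y) dotNr. Qed.

Lemma dotBl x y z : dot (x - y) z = dot x z - dot y z.
Proof. by rewrite !(dotC _ z) dotBr. Qed.

Lemma dot0r x : dot x 0 = 0.
Proof. by rewrite -(scale0r 0) dotZr mul0r. Qed.

Lemma dot0l x : dot 0 x = 0.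
Proof. by rewrite dotC dot0r. Qed.

Lemma dot_sumr (I : finType) x (F : I -> 'rV[R]_n) :
  dot x (\sum_i F i) = \sum_i dot x (F i).
Proof. by apply: (big_morph (dot x)) => [y z|]; rewrite ?dotDr ?dot0r. Qed.

Lemma mulmx_dot m (x : 'rV[R]_n) (A : 'M[R]_(n, m)) j :
  (x *m A) 0 j = dot x (col j A)^T.
Proof. by rewrite mxE; apply: eq_bigr => i _; rewrite !mxE. Qed.

Lemma mul_tr_dot m (A : 'M[R]_(m, n)) y i :
  (A *m y^T) i 0 = dot (row i A) y.
Proof. by rewrite mxE; apply: eq_bigr => j _; rewrite !mxE. Qed.

End Dot.

Section MaxNorm.
Context {R : realType} {n : nat}.
Implicit Types (x y z f : 'rV[R]_n).

Lemma coord_le_norm x i : `|x 0 i| <= `|x|.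
Proof.
rewrite [leRHS]/Num.norm /= mx_normrE.
by apply/bigmax_geP; right => /=; exists (0, i).
Qed.

Lemma norm_le_coord x c : 0 <= c -> (forall i, `|x 0 i| <= c) -> `|x| <= c.
Proof.
move=> c0 h; rewrite [leLHS]/Num.norm /= mx_normrE.
by apply/bigmax_leP; split=> // -[j i] _ /=; rewrite ord1.
Qed.

Lemma norm_attained x : x != 0 -> exists i, `|x| = `|x 0 i|.
Proof.
move=> x0; have {}x0 : mx_norm x != 0 by rewrite -[mx_norm x]/`|x| normr_eq0.
have [[j i] h] := mx_norm_neq0 x0; exists i.
by rewrite [LHS]/Num.norm /= h /= ord1.
Qed.

Lemma dot_le_norm f x : `|dot f x| <= n%:R * `|f| * `|x|.
Proof.
apply: (le_trans (ler_norm_sum _ _ _)).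
have -> : n%:R * `|f| * `|x| = \sum_(i < n) `|f| * `|x|.
  by rewrite sumr_const card_ord -mulrA mulr_natl.
by apply: ler_sum => i _; rewrite normrM ler_pM// coord_le_norm.
Qed.

Lemma dot_ge0 x : 0 <= dot x x.
Proof. by apply: sumr_ge0 => i _; rewrite -expr2 sqr_ge0. Qed.

Lemma sqr_coord_le_dot x i : x 0 i ^+ 2 <= dot x x.
Proof.
rewrite /dot (bigD1 i)//= expr2 lerDl.
by apply: sumr_ge0 => j _; rewrite -expr2 sqr_ge0.
Qed.

Lemma dot_eq0 x : dot x x = 0 -> x = 0.
Proof.
move=> d0; apply/rowP => i; rewrite mxE; apply/eqP; rewrite -sqrf_eq0.
by rewrite eq_le sqr_ge0 andbT -d0 sqr_coord_le_dot.
Qed.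

Lemma dot_gt0 x : x != 0 -> 0 < dot x x.
Proof.
move=> x0; rewrite lt_neqAle dot_ge0 andbT eq_sym.
by apply: contra x0 => /eqP/dot_eq0 ->.
Qed.

Lemma norm_lt_of_dot x c : 0 <= c -> dot x x <= c ^+ 2 -> `|x| <= c.
Proof.
move=> c0 h; apply: norm_le_coord => // i.
rewrite -(ler_pXn2r (n := 2)) ?nnegrE// real_normK ?num_real//.
exact: le_trans (sqr_coord_le_dot x i) h.
Qed.

Lemma dot_continuous (c : 'rV[R]_n) : continuous (fun x => dot (x - c) (x - c)).
Proof.
have h i : continuous (fun y : 'rV[R]_n => (y - c) 0 i).
  move=> y; apply: (@continuous_comp _ _ _ (fun y : 'rV[R]_n => y - c)
    (fun y : 'rV[R]_n => y 0 i)); last exact: coord_continuous.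
  exact: (cvgB cvg_id (cvg_cst _)).
rewrite /dot; apply: continuous_big => [|i _ x]; first exact: add_continuous.
exact: (cvgM (h i x) (h i x)).
Qed.

End MaxNorm.

(** * Convex sets that span the space *)

Section ConvexSets.
Context {R : realType}.

Lemma convex_combination (V : lmodType R) (K : set V) (x y : V) (a : R) :
  convex_set K -> 0 <= a <= 1 -> K x -> K y -> K (a *: x + (1 - a) *: y).
Proof.
move=> cK /andP[a0 a1] Kx Ky.
have ha : Itv.spec (Itv.num_sem (R:=R)) (Itv.Real `[0, 1]%Z) a.
  by rewrite /Itv.spec/= /Itv.num_sem/= num_real in_itv/= a0 a1.
pose p : {i01 R} := Itv.mk ha.
have := cK x y p; rewrite !inE => /(_ Kx Ky).
by rewrite /conv/=.
Qed.

Lemma convex_sum (V : lmodType R) (K : set V) m (w : 'I_m.+1 -> R)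
    (v : 'I_m.+1 -> V) :
  convex_set K -> (forall i, 0 < w i) -> (forall i, K (v i)) ->
  \sum_i w i = 1 -> K (\sum_i w i *: v i).
Proof.
move=> cK w0 Kv w1.
(* Positive weights of arbitrary total make the induction go through. *)
suff H : 0 < \sum_i w i /\ K ((\sum_i w i)^-1 *: \sum_i w i *: v i).
  by case: H => _; rewrite w1 invr1 scale1r.
elim: m w v w0 Kv {w1} => [|m IH] w v w0 Kv.
  rewrite !big_ord1 scalerA mulVf ?scale1r; last by rewrite gt_eqF.
  by split.
have [||s0 Ks] := IH (fun i => w (widen_ord (leqnSn _) i))
  (fun i => v (widen_ord (leqnSn _) i)); [by move=> i | by move=> i |].
rewrite !(big_ord_recr m.+1)/=; set s := \sum_(i < _) _ in s0 Ks *.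
set S := \sum_(i < _) _ in Ks *; have wm := w0 ord_max.
have sw : 0 < s + w ord_max by rewrite addr_gt0.
split=> //.
have := @convex_combination _ K (s^-1 *: S) (v ord_max)
  (s / (s + w ord_max)) cK _ Ks (Kv _).
have -> : 1 - s / (s + w ord_max) = (s + w ord_max)^-1 * w ord_max.
  by field; rewrite gt_eqF.
rewrite scalerDr !scalerA.
have -> : s / (s + w ord_max) / s = (s + w ord_max)^-1.
  by field; rewrite !gt_eqF.
apply; apply/andP; split; first by rewrite divr_ge0// ltW.
by rewrite ler_pdivrMr// mul1r lerDl ltW.
Qed.

End ConvexSets.

Section Simplex.
Context {R : realType} {n : nat}.
Implicit Types (K : set 'rV[R]_n.+1) (x y z f : 'rV[R]_n.+1).

(** Vectors of [K] are added one at a time: as long as there are too few, some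
    [f] vanishes on all of them, and the next one is taken off its kernel. *)
Lemma spanning_basis K :
  (forall f, f != 0 -> exists2 y, K y & dot f y != 0) ->
  exists B : 'M[R]_n.+1, (forall i, K (row i B)) /\ B \in unitmx.
Proof.
move=> spK.
suff H k : (k <= n.+1)%N ->
    exists B : 'M[R]_(k, n.+1), (forall i, K (row i B)) /\ row_free B.
  have [B [KB fB]] := H n.+1 (leqnn _).
  by exists B; split=> //; rewrite -row_free_unit.
elim: k => [_|k IH kn].
  exists 0; split; first by case.
  by rewrite -kermx_eq0 -subr_eq0 -mxrank_eq0 -leqn0 rank_leq_row.
have [B [KB fB]] := IH (ltnW kn).
have /rowV0Pn [v /sub_kermxP vB v0] : kermx B^T != 0.
  rewrite kermx_eq0 -row_leq_rank mxrank_tr -ltnNge.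
  exact: leq_ltn_trans (rank_leq_row _) kn.
have [y Ky vy] := spK v v0.
have Bv : B *m v^T = 0 by rewrite -[LHS]trmxK trmx_mul trmxK vB trmx0.
have KC (i : 'I_(1 + k)) : K (row i (col_mx y B)).
  have [j ->|j ->] := split_ordP i; last by rewrite rowKd.
  by rewrite rowKu ord1 (_ : row 0 y = y)//; apply/rowP => l; rewrite mxE.
suff RC : row_free (col_mx y B).
  by exists (col_mx y B : 'M[R]_(1 + k, n.+1)); split=> // i; exact: KC.
apply: inj_row_free => u; rewrite -(hsubmxK u) mul_row_col => h.
set a := lsubmx _ in h *; set b := rsubmx _ in h *.
have : (a *m y + b *m B) *m v^T = 0 by rewrite h mul0mx.
rewrite mulmxDl -!mulmxA Bv mulmx0 addr0.
have -> : y *m v^T = (dot v y)%:M.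
  by rewrite [LHS]mx11_scalar mul_tr_dot dotC; congr (dot _ _)%:M;
     apply/rowP => l; rewrite mxE.
rewrite mul_mx_scalar => /eqP; rewrite scaler_eq0 (negPf vy)/= => /eqP a0.
move: h; rewrite a0 mul0mx add0r => /eqP; rewrite mulmx_free_eq0// => /eqP ->.
by rewrite row_mx0.
Qed.

(** If the rows of an invertible matrix lie in a convex set [K], then their
    centroid has a neighbourhood, inside the affine hyperplane that they span,
    contained in [K]: barycentric coordinates depend continuously on the
    point. *)
Lemma centroid_relative_ball K (B : 'M[R]_n.+1) f :
  convex_set K -> (forall i, K (row i B)) -> B \in unitmx ->
  (forall i, dot f (row i B) = 1) ->
  exists2 e, 0 < e & forall z, `|z| <= e -> dot f z = 0 ->
    K (n.+1%:R^-1 *: \sum_i row i B + z).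
Proof.
move=> cK KB uB fB.
pose D := \sum_i (n.+1%:R * `|(col i (invmx B))^T|).
have D0 : 0 <= D by apply: sumr_ge0 => i _; rewrite mulr_ge0.
have N0 : 0 < n.+1%:R :> R by [].
exists ((n.+1%:R * (D + 1))^-1); first by rewrite invr_gt0 mulr_gt0// ltr_wpDl.
move=> z ze fz; pose a := z *m invmx B.
have za : z = \sum_i a 0 i *: row i B by rewrite -mulmx_sum_row mulmxKV.
have sa : \sum_i a 0 i = 0.
  transitivity (dot f z) => //; rewrite [in RHS]za dot_sumr.
  by apply: eq_bigr => i _; rewrite dotZr fB mulr1.
have -> : n.+1%:R^-1 *: \sum_i row i B + z =
    \sum_i (n.+1%:R^-1 + a 0 i) *: row i B.
  rewrite {1}za scaler_sumr -big_split/=.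
  by apply: eq_bigr => i _; rewrite scalerDl.
apply: convex_sum => // [i|]; last first.
  rewrite big_split/= sa addr0 sumr_const card_ord -[LHS]mulr_natr.
  by rewrite mulVf.
suff : `|a 0 i| < n.+1%:R^-1 by rewrite ltr_norml -ltrBlDl sub0r => /andP[].
rewrite /a mulmx_dot; apply: le_lt_trans (dot_le_norm _ _) _.
have hD : n.+1%:R * `|(col i (invmx B))^T| <= D.
  rewrite /D (bigD1 i)//= lerDl.
  by apply: sumr_ge0 => j _; rewrite mulr_ge0.
rewrite mulrAC; apply: le_lt_trans (_ : D * (n.+1%:R * (D + 1))^-1 < _).
  by apply: ler_pM => //; rewrite mulr_ge0.
rewrite invfM mulrCA gtr_pMr ?invr_gt0// ltr_pdivrMr ?mul1r ?ltrDl//.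
by rewrite ltr_wpDl.
Qed.

(** A relative ball of an affine hyperplane together with a point off that
    hyperplane spans a cone with interior. *)
Lemma off_plane_ball K f x y e :
  convex_set K -> 0 < e -> dot f y != dot f x -> K y ->
  (forall z, `|z| <= e -> dot f z = 0 -> K (x + z)) ->
  exists c d, 0 < d /\ forall z, `|z| <= d -> K (c + z).
Proof.
move=> cK e0 fyx Ky Kx.
pose s := dot f y - dot f x; have s0 : s != 0 by rewrite subr_eq0.
pose M := n.+1%:R * `|f| / `|s|.
have M0 : 0 <= M by rewrite divr_ge0// mulr_ge0.
pose d := Num.min (4^-1 / (M + 1)) (e / 4 / (M * `|y - x| + 1)).
have M1 : 0 < M + 1 by rewrite ltr_wpDl.
have M2 : 0 < M * `|y - x| + 1 by rewrite ltr_wpDl// mulr_ge0.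
exists (2^-1 *: (x + y)), d; split.
  by rewrite lt_min; apply/andP; split; rewrite !divr_gt0.
move=> h; rewrite le_min => /andP[hd1 hd2].
rewrite ler_pdivlMr// in hd1; rewrite ler_pdivlMr// in hd2.
(* [1 - m] is the weight of [y] that puts the combination at the right height *)
pose m := 2^-1 - dot f h / s.
have mb : `|m - 2^-1| <= M * `|h|.
  rewrite /m addrAC subrr add0r normrN normrM normfV ler_pdivrMr ?normr_gt0//.
  rewrite /M -!mulrA [_^-1 * _]mulrC -!mulrA mulfV ?normr_eq0// mulr1 mulrA.
  exact: dot_le_norm.
have mb' : `|m - 2^-1| <= 4^-1.
  apply: le_trans mb _; have := normr_ge0 h; nra.
have [m1 m2] : 4^-1 <= m /\ m <= 3 * 4^-1.
  move: mb'; rewrite ler_norml => /andP[]; split; lra.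
pose z := m^-1 *: ((m - 2^-1) *: (y - x) + h).
have m0 : m != 0 by rewrite gt_eqF//; lra.
have -> : 2^-1 *: (x + y) + h = m *: (x + z) + (1 - m) *: y.
  by apply/rowP => i; rewrite /z !mxE; field.
apply: convex_combination => //; first by apply/andP; split; lra.
apply: Kx.
  rewrite normrZ normfV (ger0_norm (_ : 0 <= m)); last by lra.
  rewrite ler_pdivrMl; last lra.
  apply: le_trans (ler_normD _ _) _; rewrite normrZ.
  have h1 : `|m - 2^-1| * `|y - x| <= M * `|h| * `|y - x|.
    by rewrite ler_wpM2r.
  have : M * `|h| * `|y - x| + `|h| <= e / 4 by lra.
  nra.
rewrite dotZr dotDr dotZr dotBr -/s; apply/eqP.
rewrite mulf_eq0 /m; apply/orP; right; apply/eqP; field.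
exact: s0.
Qed.

End Simplex.

(** * Smooth support points *)

(** To first order at [x], the set [K] contains the hyperplane orthogonal to [f]
    when [k = 0], and the half-space above that hyperplane when [k = 1].  Giving
    the height of [z] exactly lets one argument treat both cases. *)
Definition smooth_support (R : realType) (n : nat) (K : set 'rV[R]_n)
    (f : 'rV[R]_n) (k : R) (x : 'rV[R]_n) : Prop :=
  (forall y, K y -> dot f x <= dot f y) /\
  forall C, 0 < C -> exists2 t0, 0 < t0 &
    forall t z, 0 < t -> t < t0 -> `|z| <= C * t -> dot f z = k * t ->
      K (x + z).

Section SmoothSupport.
Context {R : realType} {n : nat}.
Implicit Types (K : set 'rV[R]_n.+1) (x y z f : 'rV[R]_n.+1).

Lemma smooth_supportZ K f k x a : 0 < a ->
  smooth_support K f k x -> smooth_support K (a *: f) k x.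
Proof.
move=> a0 [Kf Kx]; split=> [y Ky|C C0]; first by rewrite !dotZl ler_pM2l ?Kf.
have [|t0 t00 H] := Kx (C * a); first exact: mulr_gt0.
exists (a * t0); first exact: mulr_gt0.
move=> t z t_gt0 tt0 zC fz; apply: (H (t / a)).
- exact: divr_gt0.
- by rewrite ltr_pdivrMr// mulrC.
- by rewrite -mulrA [a * _]mulrC divfK// gt_eqF.
- by rewrite mulrA -fz dotZl mulrAC divff ?mul1r// gt_eqF.
Qed.

(** The distance to [c] attains its minimum on the closure of the complement,
    because only the part inside the ball through [z1] matters. *)
Lemma nearest_complement_point K c z1 : ~ K z1 ->
  exists2 x, closure (~` K) x &
    forall y, dot (y - c) (y - c) < dot (x - c) (x - c) -> K y.
Proof.
move=> Kz1; pose g y := dot (y - c) (y - c).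
pose A := closure (~` K) `&` g @^-1` [set r | r <= g z1].
have A1 : A z1 by split; [exact: subset_closure | rewrite /= lexx].
have cA : compact A.
  apply: bounded_closed_compact.
    exists (`|c| + (g z1 + 1)); split; first exact: num_real.
    move=> M HM y [_ /= hy]; apply: le_trans (ltW HM).
    rewrite -[y](subrK c) addrC; apply: le_trans (ler_normD _ _) _.
    rewrite lerD2l; have g0 : 0 <= g z1 by exact: dot_ge0.
    apply: norm_lt_of_dot; first by rewrite addr_ge0.
    by apply: le_trans hy _; nra.
  apply: closedI; first exact: closed_closure.
  apply: closed_comp; last exact: closed_le.
  by move=> y _; exact: dot_continuous.
have cg : {within A, continuous g}.
  by apply: continuous_subspaceT => y; exact: dot_continuous.
have [x + xmin] := EVT_min_rV (ex_intro _ _ A1) cA cg.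
rewrite inE => -[Dx xz1]; exists x => // y hy.
apply: contrapT => Ky; move: hy; rewrite ltNge => /negP; apply.
have [h|/ltW h] := leP (g y) (g z1); last exact: le_trans xz1 h.
by apply: xmin; rewrite inE; split=> //; exact: subset_closure.
Qed.

(** The supporting functional at the point where a maximal Euclidean ball about
    [c] touches the boundary.  If [K] had a point strictly below the tangent
    plane, joining it to the ball would make the touching point interior. *)
Lemma inscribed_ball_support K c d z1 : convex_set K -> ~ K z1 -> 0 < d ->
  (forall z, `|z| <= d -> K (c + z)) ->
  exists f x, f != 0 /\ smooth_support K f 1 x.
Proof.
move=> cK Kz1 d0 Kc; have [x Dx xball] := nearest_complement_point c Kz1.
have xc : c != x.
  apply/eqP => cx; rewrite -cx in Dx.
  have [y [Ky]] := Dx _ (nbhsx_ballx c d d0).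
  rewrite -ball_normE/= => /ltW cy; apply: Ky.
  by rewrite -(subrK c y) addrC; apply: Kc; rewrite distrC.
pose f := c - x; exists f, x; split; first by rewrite subr_eq0.
split=> [y Ky|C C0].
  rewrite leNgt; apply/negP => fyx.
  pose a := dot f x - dot f y; have a0 : 0 < a by rewrite subr_gt0.
  pose b := dot (x - y) (x - y); have b0 : 0 <= b := dot_ge0 _.
  (* moving from [y] through [x] a little further enters the ball *)
  pose e := a / (b + 1); have b1 : 0 < b + 1 by rewrite ltr_wpDl.
  have e0 : 0 < e by rewrite divr_gt0.
  have e1 : 0 < 1 + e by rewrite addr_gt0.
  have e1n : 1 + e != 0 by rewrite gt_eqF.
  pose c' := (1 + e)^-1 *: (c + e *: y).
  have shift y' : y' + e *: (y' - y) - c = (1 + e) *: (y' - c').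
    by apply/rowP => i; rewrite !mxE; field.
  have hx : dot (x - c') (x - c') < dot (x - c) (x - c) / (1 + e) ^+ 2.
    rewrite ltr_pdivlMr ?exprn_gt0//.
    have -> : dot (x - c') (x - c') * (1 + e) ^+ 2 =
        dot (x + e *: (x - y) - c) (x + e *: (x - y) - c).
      by rewrite shift dotZl dotZr; ring.
    have expand (p q : 'rV[R]_n.+1) :
        dot (p + e *: q) (p + e *: q) =
        dot p p + e * (2 * dot p q + e * dot q q).
      by rewrite dotDl !dotDr !dotZl !dotZr (dotC q p); ring.
    rewrite addrAC expand -/b gtrDl pmulr_rlt0//.
    have -> : dot (x - c) (x - y) = - a by rewrite -(opprB c x) dotNl dotBr.
    have : e * b < a by rewrite mulrAC ltr_pdivrMr// ltr_pM2l// ltrDl.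
    lra.
  have [y' [Ky' hy']] := Dx _ (cvgr_lt _ (@dot_continuous R n.+1 c' x) _ hx).
  apply: Ky'; pose w := y' + e *: (y' - y).
  have -> : y' = (1 + e)^-1 *: w + (1 - (1 + e)^-1) *: y.
    by apply/rowP => i; rewrite /w !mxE; field.
  apply: convex_combination => //.
    by rewrite invr_ge0 ltW//= invf_le1// lerDl ltW.
  apply: xball; rewrite shift dotZl dotZr mulrA -expr2 mulrC.
  by rewrite -ltr_pdivlMr ?exprn_gt0.
exists (n.+1%:R * C ^+ 2)^-1.
  by rewrite invr_gt0 mulr_gt0// exprn_gt0.
move=> t z t0 tt zC; rewrite mul1r => fz; apply: xball.
have -> : x + z - c = z - f by rewrite /f opprB addrA addrAC addrC addrA.
have -> : x - c = - f by rewrite opprB.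
have expand (p q : 'rV[R]_n.+1) :
    dot (p - q) (p - q) = dot p p - 2 * dot q p + dot q q.
  by rewrite dotBl !dotBr (dotC p q); ring.
rewrite dotNl dotNr opprK expand fz.
have zz : dot z z <= n.+1%:R * (C ^+ 2 * t ^+ 2).
  apply: le_trans (ler_norm _) _; apply: le_trans (dot_le_norm _ _) _.
  by rewrite -mulrA ler_pM2l// -exprMn expr2 ler_pM.
have : n.+1%:R * (C ^+ 2 * t ^+ 2) < t.
  have -> : n.+1%:R * (C ^+ 2 * t ^+ 2) = n.+1%:R * C ^+ 2 * t * t by ring.
  rewrite gtr_pMl// -ltr_pdivlMl ?mulr1//.
  by rewrite mulr_gt0// exprn_gt0.
lra.
Qed.

(** The simplex on a basis contained in [K] spans an affine hyperplane.  If [K]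
    lies in it, the centroid of the simplex serves; otherwise [K] has interior. *)
Lemma spanning_smooth_support K z1 : convex_set K -> ~ K z1 ->
  (forall f, f != 0 -> exists2 y, K y & dot f y != 0) ->
  exists f k x, [/\ `|f| = 1, 0 <= k <= 1 & smooth_support K f k x].
Proof.
move=> cK Kz1 spK.
suff [f [k [x [f0 k01 sf]]]] :
    exists f k x, [/\ f != 0, 0 <= k <= 1 & smooth_support K f k x].
  exists (`|f|^-1 *: f), k, x; split=> //; last first.
    by apply: smooth_supportZ => //; rewrite invr_gt0 normr_gt0.
  by rewrite normrZ normfV normr_id mulVf// normr_eq0.
have [B [KB uB]] := spanning_basis spK.
pose f : 'rV[R]_n.+1 := (invmx B *m const_mx 1)^T.
have fB i : dot f (row i B) = 1.
  by rewrite dotC -mul_tr_dot trmxK mulmxA mulmxV// mul1mx mxE.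
have f0 : f != 0.
  by apply/eqP => f0; move/eqP: (fB 0); rewrite f0 dot0l eq_sym oner_eq0.
have [e e0 Kx] := centroid_relative_ball cK KB uB fB.
set x := _ *: _ in Kx.
have fx : dot f x = 1.
  rewrite dotZr dot_sumr; under eq_bigr do rewrite fB.
  by rewrite sumr_const card_ord mulVf.
have [[y Ky fy]|Kf] := pselect (exists2 y, K y & dot f y != 1).
  rewrite -fx in fy; have [c [d [d0 Kc]]] := off_plane_ball cK e0 fy Ky Kx.
  have [g [x' [g0 sg]]] := inscribed_ball_support cK Kz1 d0 Kc.
  by exists g, 1, x'; split=> //; rewrite ler01 lexx.
exists f, 0, x; split; rewrite ?lexx ?ler01//; split=> [y Ky|C C0].
  rewrite fx; have [->//|fy] := eqVneq (dot f y) 1.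
  by case: Kf; exists y.
exists (e / C); first exact: divr_gt0.
move=> t z t0 tt zC; rewrite mul0r; apply: Kx.
by apply: le_trans zC _; rewrite mulrC -ler_pdivlMr// ltW.
Qed.

End SmoothSupport.

(** * The displacement of a point by a Lipschitz retraction *)

(** Approximate form of: the projection along [u] onto the kernel of [f] is a
    contraction.  Indeed, when [N e = dot g e = 1] and [dot f e > 0], moving [e]
    towards the kernel of [f] along [- u] must not increase [g]. *)
Definition almost_contractive (R : realType) (n : nat) (N : 'rV[R]_n -> R)
    (eta delta : R) (f u : 'rV[R]_n) : Prop :=
  forall e g, N e <= 1 -> (forall x, dot g x <= N x) -> dot g e = 1 ->
    eta <= dot f e -> - delta <= dot g u.

Section RetractionDisplacement.
Context {R : realType} {n : nat} {N : 'rV[R]_n.+1 -> R}.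
Context (NZ : forall a x, N (a *: x) = `|a| * N x) (E : R)
  (normE : forall x, `|x| <= E * N x).

(** A Lipschitz retraction [r] onto [K] is tested at one point [p] just below a
    smooth support point of [K]; [u] is the rescaled displacement of [p].
    Every direction [e] going up reaches [K] from [p], at a point that [r]
    fixes, and the Lipschitz bound between the two points controls [u]. *)
Lemma retraction_almost_contractive (K : set 'rV[R]_n.+1) r lambda f k x eta :
  1 <= lambda -> 0 < eta -> `|f| = 1 -> 0 <= k <= 1 -> smooth_support K f k x ->
  retraction_onto K r -> (forall y z, N (r y - r z) <= lambda * N (y - z)) ->
  exists2 u, 1 <= dot f u &
    almost_contractive N eta ((lambda - 1) * (2 / eta)) f u.
Proof.
move=> l1 eta0 f1 /andP[k0 k1] [Kf Kx] [rK rid] rL.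
have f0 : f != 0 by rewrite -normr_eq0 f1 oner_eq0.
have ff : 0 < dot f f := dot_gt0 f0.
have [v fv] : exists v, dot f v = 1.
  by exists ((dot f f)^-1 *: f); rewrite dotZr mulVf// gt_eqF.
pose C := `|v| + 2 / eta * `|E| + 1.
have e2 : 0 <= 2 / eta by rewrite divr_ge0// ltW.
have C0 : 0 < C by rewrite ltr_wpDl// addr_ge0// mulr_ge0.
have [t0 t00 H] := Kx C C0.
have [t [t_gt0 tt0]] : exists t, 0 < t /\ t < t0 by exists (t0 / 2); lra.
pose p := x - t *: v; exists (t^-1 *: (r p - p)).
  rewrite dotZr ler_pdivlMl// mulr1 /p !dotBr dotZr fv.
  have := Kf _ (rK p); rewrite /p; lra.
move=> e g Ne gN ge fe.
have fe0 : 0 < dot f e := lt_le_trans eta0 fe.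
pose s := (1 + k) / dot f e.
have s0 : 0 < s by rewrite divr_gt0// ltr_pwDl.
have s2 : s <= 2 / eta.
  rewrite /s ler_pdivrMr// mulrAC ler_pdivlMr//.
  by apply: ler_pM => //; [rewrite addr_ge0 | exact: ltW | lra].
(* The ray from [p] in the direction [e] is at height [k * t] at time [s * t]. *)
pose y := x + ((s * t) *: e - t *: v).
have Ky : K y.
  apply: (H t) => //; last first.
    by rewrite dotBr !dotZr fv /s; field; rewrite gt_eqF.
  apply: le_trans (ler_normB _ _) _.
  rewrite [`|(s * t) *: e|]normrZ [`|t *: v|]normrZ.
  rewrite (gtr0_norm t_gt0) (gtr0_norm (mulr_gt0 s0 t_gt0)).
  have ne : `|e| <= `|E|.
    apply: le_trans (normE e) _; apply: le_trans (ler_norm _) _.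
    have N0 : 0 <= N e by have := NZ (-1) e; have := gN (-e); have := gN e;
      rewrite dotNr scaleN1r normrN1 mul1r => ? ? ?; lra.
    by rewrite normrM (ger0_norm N0) ler_piMr.
  have : s * `|e| <= 2 / eta * `|E| by rewrite ler_pM// ltW.
  have -> : s * t * `|e| + t * `|v| = (`|v| + s * `|e|) * t by ring.
  by rewrite ler_pM2r// /C; lra.
have := rL y p; rewrite (rid y Ky).
have -> : y - p = (s * t) *: e.
  by apply/rowP => i; rewrite /y /p !mxE; ring.
rewrite NZ (gtr0_norm (mulr_gt0 s0 t_gt0)) => h.
have {}h : dot g (y - r p) <= lambda * (s * t).
  apply: le_trans (gN _) (le_trans h _).
  rewrite ler_pM2l ?(lt_le_trans ltr01)//.
  by rewrite ler_piMr// mulr_ge0// ltW.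
have gy : dot g (y - r p) = s * t - dot g (r p - p).
  have -> : y - r p = (s * t) *: e - (r p - p).
    by apply/rowP => i; rewrite /y /p !mxE; ring.
  by rewrite dotBr dotZr ge mulr1.
rewrite dotZr ler_pdivlMl//.
have : (lambda - 1) * s <= (lambda - 1) * (2 / eta).
  by rewrite ler_wpM2l// subr_ge0.
rewrite -(ler_pM2r t_gt0); move: h; rewrite gy; nra.
Qed.

End RetractionDisplacement.

(** * A norm whose unit ball has crossed facets along every plane *)

Section ThreeSpace.
Context {R : realType}.
Implicit Types (x f u : 'rV[R]_3) (a b c : R).

Definition vec3 a b c : 'rV[R]_3 := \row_i nth 0 [:: a; b; c] i.

Definition rotate x : 'rV[R]_3 := vec3 (x 0 2) (x 0 0) (x 0 1).

Lemma vec3_eta x : x = vec3 (x 0 0) (x 0 1) (x 0 2).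
Proof.
by apply/rowP => i; rewrite mxE; case: i => [[|[|[|//]]]] ?/=;
  congr (x _ _); apply/val_inj.
Qed.

Lemma rotate_vec3 a b c : rotate (vec3 a b c) = vec3 c a b.
Proof. by rewrite /rotate !mxE. Qed.

Lemma oppr_vec3 a b c : - vec3 a b c = vec3 (- a) (- b) (- c).
Proof. by apply/rowP => i; rewrite !mxE; case: i => [[|[|[|//]]]] ?. Qed.

Lemma dot_vec3 a b c a' b' c' :
  dot (vec3 a b c) (vec3 a' b' c') = a * a' + b * b' + c * c'.
Proof. by rewrite /dot !big_ord_recr big_ord0/= !mxE/= add0r. Qed.

(** Seven pairs of facets and twelve pairs of vertices.  No reflection may
    preserve the polytope: it would yield a contractive projection onto its
    mirror.  The cyclic shift of the coordinates has odd order, so that it is a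
    harmless symmetry; it divides the number of cases by three. *)
Definition facet (j : nat) : 'rV[R]_3 :=
  nth 0 [:: vec3 1 0 (-2); vec3 (-2) 1 0; vec3 0 (-2) 1;
            vec3 3 1 0; vec3 0 3 1; vec3 1 0 3; vec3 3 3 3] j.

(** The norm embeds the space into a seven-dimensional one with the maximum
    norm, from which it inherits the triangle inequality. *)
Definition facet_mx : 'M[R]_(3, 7) := \matrix_(i, j) facet j 0 i.

Definition polyhedral_norm x : R := `|x *m facet_mx|.

Local Notation N := polyhedral_norm.

Lemma mul_facet_mx x (j : 'I_7) : (x *m facet_mx) 0 j = dot (facet j) x.
Proof. by rewrite mxE; apply: eq_bigr => i _; rewrite mxE mulrC. Qed.

Lemma dot_facet_le x j : (j < 7)%N -> `|dot (facet j) x| <= N x.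
Proof. by move=> j7; rewrite -(mul_facet_mx x (Ordinal j7)) coord_le_norm. Qed.

Lemma polyhedral_norm_le x m : 0 <= m ->
  (forall j, (j < 7)%N -> `|dot (facet j) x| <= m) -> N x <= m.
Proof.
by move=> m0 H; apply: norm_le_coord => // j; rewrite mul_facet_mx H.
Qed.

Lemma polyhedral_normZ a x : N (a *: x) = `|a| * N x.
Proof. by rewrite /N -scalemxAl normrZ. Qed.

Lemma polyhedral_norm_rotate x : N (rotate x) <= N x.
Proof.
apply: polyhedral_norm_le => [|j j7]; first exact: normr_ge0.
pose s := nth 0 [:: 2; 0; 1; 5; 3; 4; 6]%N j.
have -> : dot (facet j) (rotate x) = dot (facet s) x.
  rewrite [x]vec3_eta rotate_vec3 /s.
  by case: j j7 {s} => [|[|[|[|[|[|[|//]]]]]]] _;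
    rewrite /facet/= !dot_vec3; ring.
by apply: dot_facet_le; case: j j7 @s => [|[|[|[|[|[|[|//]]]]]]].
Qed.

End ThreeSpace.

Local Notation N := polyhedral_norm.

Section Crossing.
Context {R : realType}.

(** The mechanism that makes [u] small: a facet cut by the kernel of [f] has
    vertices strictly on both sides; one of them bounds [dot g u] from below and
    the other one from above. *)
Lemma crossed_facet (n : nat) (M : 'rV[R]_n -> R) eta delta f u e e' g :
  (forall x, M (- x) = M x) -> almost_contractive M eta delta f u ->
  (forall x, dot g x <= M x) -> M e <= 1 -> M e' <= 1 ->
  dot g e = 1 -> dot g e' = 1 -> eta <= dot f e -> dot f e' <= - eta ->
  - delta <= dot g u <= delta.
Proof.
move=> MN H gM Me Me' ge ge' fe fe'; apply/andP; split; first exact: (H e).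
have := H (- e') (- g); rewrite MN !(dotNl, dotNr) opprK lerN2; apply=> //.
  by move=> x; rewrite dotNl -dotNr -(MN x).
by rewrite lerNr.
Qed.

Lemma facet_bound (j : nat) (x : 'rV[R]_3) :
  (j < 7)%N -> dot (facet j) x <= N x.
Proof. by move=> j7; apply: le_trans (ler_norm _) (dot_facet_le _ j7). Qed.

Lemma polyhedral_normN (x : 'rV[R]_3) : N (- x) = N x.
Proof. by rewrite -scaleN1r polyhedral_normZ normrN1 mul1r. Qed.

(** The radius [m] is a common denominator, which keeps the coordinates of the
    vertices integral. *)
Definition in_ball (m a b c : R) : Prop := 0 < m /\ N (vec3 a b c) <= m.

Lemma in_ball_facets m a b c : 0 < m ->
  - m <= a - 2 * c <= m -> - m <= b - 2 * a <= m -> - m <= c - 2 * b <= m ->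
  - m <= 3 * a + b <= m -> - m <= 3 * b + c <= m -> - m <= 3 * c + a <= m ->
  - m <= 3 * (a + b + c) <= m -> in_ball m a b c.
Proof.
move=> m0 ? ? ? ? ? ? ?; split=> //.
apply: polyhedral_norm_le => [|j j7]; [exact: ltW | rewrite ler_norml].
by case: j j7 => [|[|[|[|[|[|[|//]]]]]]] _; rewrite /facet/= dot_vec3; lra.
Qed.

Lemma rotated m a b c : in_ball m a b c -> in_ball m c a b.
Proof.
case=> m0 h; split=> //; rewrite -rotate_vec3.
exact: le_trans (polyhedral_norm_rotate _) h.
Qed.

Lemma opposite m a b c : in_ball m a b c -> in_ball m (- a) (- b) (- c).
Proof. by case=> m0 h; split=> //; rewrite -oppr_vec3 polyhedral_normN. Qed.

(* The vertices of the unit ball are, up to sign and cyclic shift, the four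
   points below divided by their radius. *)
Lemma vertexP : in_ball 10 4 (-2) (-3).
Proof. by apply: in_ball_facets; lra. Qed.

Lemma vertexQ : in_ball 15 6 (-3) 2.
Proof. by apply: in_ball_facets; lra. Qed.

Lemma vertexS : in_ball 24 5 9 (-6).
Proof. by apply: in_ball_facets; lra. Qed.

Lemma vertexT : in_ball 13 3 4 (-5).
Proof. by apply: in_ball_facets; lra. Qed.

Lemma crossed_facet_vec3 (j : nat) (q r u0 u1 u2 d g0 g1 g2 : R) :
  almost_contractive N (1 / 125) d (vec3 1 q r) (vec3 u0 u1 u2) ->
  (j < 7)%N -> facet j = vec3 g0 g1 g2 ->
  forall m a b c m' a' b' c', in_ball m a b c -> in_ball m' a' b' c' ->
  g0 * a + g1 * b + g2 * c = m -> g0 * a' + g1 * b' + g2 * c' = m' ->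
  m <= 125 * (a + b * q + c * r) -> 125 * (a' + b' * q + c' * r) <= - m' ->
  - d <= g0 * u0 + g1 * u1 + g2 * u2 <= d.
Proof.
move=> H j7 gE m a b c m' a' b' c' [m0 hm] [m'0 hm'] ge ge' fe fe'.
have unit (n x y z : R) :
    0 < n -> N (vec3 x y z) <= n -> N (n^-1 *: vec3 x y z) <= 1.
  move=> n0 h; rewrite polyhedral_normZ gtr0_norm ?invr_gt0//.
  by rewrite ler_pdivrMl ?mulr1.
have h := crossed_facet polyhedral_normN H (fun x => facet_bound x j7)
  (unit _ _ _ _ m0 hm) (unit _ _ _ _ m'0 hm').
rewrite -dot_vec3 -gE; apply: h.
- by rewrite gE dotZr dot_vec3 ge mulVf// gt_eqF.
- by rewrite gE dotZr dot_vec3 ge' mulVf// gt_eqF.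
- by rewrite dotZr dot_vec3 ler_pdivlMl//; lra.
- by rewrite dotZr dot_vec3 ler_pdivrMl//; lra.
Qed.

(* [cut H j e e'] bounds facet [j] at [u], given that the vertices [e] and [e']
   of that facet lie above and below the kernel of [f]. *)
Ltac cut H j e e' :=
  let K := fresh in
  unshelve epose proof
    (crossed_facet_vec3 (j := j) H isT erefl e e' _ _ _ _) as K;
  [clear; lra | clear; lra | lra | lra | ].

(** Every plane cuts three facets with linearly independent normals, with a
    margin of 1/125 at the vertices.  The square of all [(q, r)] is divided
    by lines on which a vertex is at that margin; on each of the thirteen pieces
    three facets are exhibited, each with one vertex above the plane and one
    below it. *)
Lemma three_facets_crossed (q r u0 u1 u2 d : R) :
  -1 <= q <= 1 -> -1 <= r <= 1 -> 0 <= d ->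
  almost_contractive N (1 / 125) d (vec3 1 q r) (vec3 u0 u1 u2) ->
  [/\ -(4 * d) <= u0 <= 4 * d, -(4 * d) <= u1 <= 4 * d
    & -(4 * d) <= u2 <= 4 * d].
Proof.
move=> /andP[q1 q2] /andP[r1 r2] d0 H.
suff : (-(4 * d) <= u0 <= 4 * d) /\ (-(4 * d) <= u1 <= 4 * d)
    /\ (-(4 * d) <= u2 <= 4 * d) by case=> ? [].
have [?|?] := lerP 15 (125 * (3 - 2 * q - 6 * r)).
  have [?|?] := ltrP (125 * (3 - 4 * q + 2 * r)) (- 10).
    by cut H 1%N (rotated vertexP) (rotated vertexT);
       cut H 4%N (rotated vertexP) (rotated vertexT);
       cut H 6%N vertexQ (rotated (rotated vertexQ)); lra.
  have [?|?] := lerP 15 (125 * (2 + 6 * q - 3 * r)).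
    by cut H 4%N (rotated vertexQ) (rotated vertexT);
       cut H 5%N (rotated (rotated vertexS)) (rotated (rotated vertexQ));
       cut H 6%N vertexQ (rotated (rotated vertexQ)); lra.
  have [?|?] := lerP 13 (125 * (3 + 4 * q - 5 * r)).
    by cut H 2%N (opposite (rotated vertexP)) (opposite vertexT);
       cut H 5%N (rotated (rotated vertexS)) (rotated (rotated vertexQ));
       cut H 6%N vertexQ (rotated vertexS); lra.
  by cut H 0%N (opposite (rotated vertexT))
       (opposite (rotated (rotated vertexP)));
     cut H 5%N (rotated (rotated vertexS)) (rotated (rotated vertexQ));
     cut H 6%N vertexQ (rotated vertexS); lra.
have [?|?] := ltrP (125 * (5 + 9 * q - 6 * r)) 24.
  by cut H 0%N (opposite (rotated vertexT)) vertexT;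
     cut H 3%N vertexQ vertexT;
     cut H 6%N vertexQ (rotated vertexQ); lra.
have [?|?] := ltrP (125 * (4 - 2 * q - 3 * r)) 10.
  by cut H 1%N (rotated vertexT) (opposite vertexQ);
     cut H 2%N (opposite (rotated vertexP)) (opposite (rotated vertexQ));
     cut H 4%N (rotated vertexT) (rotated vertexP); lra.
have [?|?] := ltrP (125 * (3 + 4 * q - 5 * r)) (- 13).
  by cut H 0%N vertexP vertexT;
     cut H 2%N (opposite vertexT) (opposite vertexS);
     cut H 3%N vertexQ vertexT; lra.
have [?|?] := ltrP (125 * (3 - 4 * q + 2 * r)) (- 10).
  by cut H 1%N (rotated vertexP) (rotated vertexT);
     cut H 4%N (rotated vertexP) (rotated vertexT);
     cut H 5%N (rotated (rotated vertexS)) (rotated (rotated vertexP)); lra.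
have [?|?] := lerP 10 (125 * (2 + 3 * q - 4 * r)).
  have [?|?] := lerP (- 15) (125 * (3 - 2 * q - 6 * r)).
    by cut H 2%N (rotated (rotated vertexT)) (opposite vertexT);
       cut H 4%N (rotated vertexQ) (rotated vertexT);
       cut H 5%N (rotated (rotated vertexS)) (rotated (rotated vertexP)); lra.
  by cut H 0%N vertexT (opposite (rotated (rotated vertexQ)));
     cut H 2%N (rotated (rotated vertexT)) (opposite vertexT);
     cut H 5%N (rotated (rotated vertexQ)) (rotated (rotated vertexP)); lra.
have [?|?] := ltrP (125 * (6 - 5 * q - 9 * r)) 24.
  by cut H 0%N vertexP (opposite (rotated (rotated vertexQ)));
     cut H 2%N (opposite (rotated vertexP)) (opposite (rotated vertexQ));
     cut H 4%N (rotated vertexQ) (rotated vertexP); lra.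
have [?|?] := lerP (- 10) (125 * (2 + 3 * q - 4 * r)).
  by cut H 2%N (opposite (rotated vertexP)) (opposite vertexT);
     cut H 4%N (rotated vertexQ) (rotated vertexT);
     cut H 6%N vertexQ (rotated vertexS); lra.
by cut H 0%N (opposite (rotated vertexT)) (opposite (rotated (rotated vertexP)));
   cut H 2%N (opposite (rotated vertexP)) (opposite vertexS);
   cut H 6%N vertexQ (rotated vertexS); lra.
Qed.

Lemma dot_rotate (x y : 'rV[R]_3) : dot (rotate x) (rotate y) = dot x y.
Proof.
by rewrite [x]vec3_eta [y]vec3_eta !rotate_vec3 !dot_vec3; ring.
Qed.

Lemma rotateK (x : 'rV[R]_3) : rotate (rotate (rotate x)) = x.
Proof. by rewrite [x]vec3_eta !rotate_vec3. Qed.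

Lemma norm_rotate (x : 'rV[R]_3) : `|rotate x| = `|x|.
Proof.
have H (y : 'rV[R]_3) : `|rotate y| <= `|y|.
  apply: norm_le_coord => // i; rewrite mxE.
  by case: i => [[|[|[|//]]]] ?/=; apply: coord_le_norm.
by apply/eqP; rewrite eq_le H -{1}[x]rotateK (le_trans (H _) (H _)).
Qed.

Lemma almost_contractive_rotate eta d (f u : 'rV[R]_3) :
  almost_contractive N eta d f u ->
  almost_contractive N eta d (rotate f) (rotate u).
Proof.
move=> H e g Ne gN ge fe.
have adj (x y : 'rV[R]_3) : dot (rotate x) y = dot x (rotate (rotate y)).
  by rewrite -{1}(rotateK y) dot_rotate.
rewrite dotC adj dotC; apply: (H (rotate (rotate e))).
- by do 2 apply: le_trans (polyhedral_norm_rotate _) _.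
- move=> x; rewrite dotC -adj dotC.
  exact: le_trans (gN _) (polyhedral_norm_rotate _).
- by rewrite !dot_rotate.
- by rewrite -adj.
Qed.

Lemma almost_contractiveNN eta d (f u : 'rV[R]_3) :
  almost_contractive N eta d f u -> almost_contractive N eta d (- f) (- u).
Proof.
move=> H e g Ne gN ge fe; rewrite dotNr -dotNl; apply: (H (- e)).
- by rewrite polyhedral_normN.
- by move=> x; rewrite dotNl -dotNr -[N x]polyhedral_normN.
- by rewrite dotNl dotNr opprK.
- by rewrite dotNr -dotNl.
Qed.

(** The displacement is small whatever the hyperplane is.  The symmetries bring
    the largest coordinate of [f] to the first place and make it equal to 1. *)
Lemma almost_contractive_small d (f u : 'rV[R]_3) : 0 <= d -> `|f| = 1 ->
  almost_contractive N (1 / 125) d f u -> `|u| <= 4 * d.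
Proof.
move=> d0 f1 H.
have first (h v : 'rV[R]_3) : `|h| = 1 -> `|h 0 0| = 1 ->
    almost_contractive N (1 / 125) d h v -> `|v| <= 4 * d.
  wlog h0 : h v / h 0 0 = 1 => [W h1 hh Hv|h1 _].
    have [h0|h0] := lerP 0 (h 0 0).
      by apply: (W h) => //; rewrite -hh ger0_norm.
    rewrite -normrN; apply: (W (- h)); rewrite ?normrN//.
    - by rewrite mxE -hh ltr0_norm.
    - by rewrite mxE normrN.
    - exact: almost_contractiveNN.
  rewrite [h]vec3_eta [v in almost_contractive _ _ _ _ v]vec3_eta h0.
  have b i : -1 <= h 0 i <= 1 by rewrite -ler_norml -h1 coord_le_norm.
  move/(three_facets_crossed (b 1) (b 2) d0) => [v0 v1 v2].
  apply: norm_le_coord => [|i]; first lra.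
  rewrite ler_norml [v]vec3_eta mxE.
  by case: i => [[|[|[|//]]]] ?/=.
have f0 : f != 0 by rewrite -normr_eq0 f1 oner_eq0.
have [i] := norm_attained f0; rewrite f1; case: i => [[|[|[|//]]]] lt fi.
- apply: (first f) => //; rewrite fi; congr `|f _ _|; exact/val_inj.
- rewrite -norm_rotate -[`|rotate u|]norm_rotate.
  apply: (first (rotate (rotate f))); rewrite ?norm_rotate//.
    by rewrite fi !mxE/=; congr `|f _ _|; apply/val_inj.
  by do 2 apply: almost_contractive_rotate.
- rewrite -norm_rotate; apply: (first (rotate f)); rewrite ?norm_rotate//.
    by rewrite fi mxE/=; congr `|f _ _|; apply/val_inj.
  exact: almost_contractive_rotate.
Qed.

Lemma le_polyhedral_norm (x : 'rV[R]_3) : `|x| <= N x.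
Proof.
have b j (j7 : (j < 7)%N) := dot_facet_le x j7.
have N0 : 0 <= N x by exact: normr_ge0.
move: (N x) N0 b => m m0; rewrite [x]vec3_eta => b.
move: (b 0%N isT) (b 1%N isT) (b 2%N isT).
rewrite /facet/= !dot_vec3 !ler_norml => b0 b1 b2;
apply: norm_le_coord => // i; rewrite mxE ler_norml.
by case: i => [[|[|[|//]]]] ?/=; lra.
Qed.

End Crossing.

(** * The Banach space *)

Definition polyhedral_space (R : realType) : Type := 'rV[R]_3.

Section PolyhedralSpace.
Context {R : realType}.

Lemma polyhedral_normD (x y : 'rV[R]_3) : N (x + y) <= N x + N y.
Proof. by rewrite /polyhedral_norm mulmxDl ler_normD. Qed.

Lemma polyhedral_norm_eq0 (x : 'rV[R]_3) : N x = 0 -> x = 0.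
Proof.
move=> x0; apply/eqP; rewrite -normr_eq0 eq_le normr_ge0 andbT -x0.
exact: le_polyhedral_norm.
Qed.

HB.instance Definition _ := GRing.Lmodule.copy (polyhedral_space R) 'rV[R]_3.

HB.instance Definition _ := Lmodule_isNormed.Build R (polyhedral_space R)
  polyhedral_normD (@polyhedral_normZ R) polyhedral_norm_eq0.

Lemma polyhedral_norm_le_norm (x : 'rV[R]_3) : N x <= 9 * `|x|.
Proof.
apply: polyhedral_norm_le => [|j j7]; first by rewrite mulr_ge0.
apply: le_trans (dot_le_norm _ _) _; rewrite ler_wpM2r//.
rewrite (_ : 9 = 3 * 3) ?ler_pM2l//; last by ring.
apply: norm_le_coord => // i.
by case: j j7 => [|[|[|[|[|[|[|//]]]]]]] _; rewrite /facet/= mxE;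
  case: i => [[|[|[|//]]]] ?/=; rewrite ler_norml; lra.
Qed.

Lemma polyhedral_ballE (x y : polyhedral_space R) e :
  ball x e y <-> N (x - y) < e.
Proof. by rewrite -ball_normE. Qed.

(** The norm is equivalent to the maximum norm, so that Cauchy filters may be
    taken to row vectors with their usual topology and back. *)
Lemma polyhedral_space_complete (F : set_system (polyhedral_space R)) :
  ProperFilter F -> cauchy F -> cvg F.
Proof.
move=> FF /cauchy_ballP Fc.
pose F' : set_system 'rV[R]_3 := F.
have F'c : cauchy F'.
  apply/cauchy_ballP => e e0; apply: filterS (Fc e e0) => -[x y].
  move=> /polyhedral_ballE xy; rewrite -ball_normE/=.
  exact: le_lt_trans (le_polyhedral_norm _) xy.
have /cvg_ex[l Fl] : cvg F' by exact: cauchy_cvg.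
apply/cvg_ex; exists l; apply/cvg_ballP => e e0.
have e9 : 0 < e / 9 by rewrite divr_gt0.
move: Fl => /cvg_ballP /(_ _ e9); apply: filterS => x.
rewrite -ball_normE/= => lx; apply/polyhedral_ballE.
apply: le_lt_trans (polyhedral_norm_le_norm _) _.
by rewrite mulrC -ltr_pdivlMr.
Qed.

HB.instance Definition _ :=
  Uniform_isComplete.Build (polyhedral_space R) polyhedral_space_complete.

Lemma polyhedral_space_separable : separable_space (polyhedral_space R).
Proof.
pose D := range (fun q : 'rV[rat]_3 => (map_mx ratr q : polyhedral_space R)).
exists D; first exact: sub_countable (card_image_le _ _) (countableP _).
move=> O [x Ox] oO.
have [e /= e0 xe] := (nbhs_ballP x O).1 (oO x Ox).
have e9 : 0 < e / 9 by rewrite divr_gt0.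
have approx (i : 'I_3) : exists q : rat, `|(x : 'rV[R]_3) 0 i - ratr q| < e / 9.
  have [|q] := @rat_in_itvoo R ((x : 'rV[R]_3) 0 i - e / 9) (x 0 i + e / 9).
    by lra.
  by rewrite in_itv/= => q9; exists q; rewrite ltr_norml; lra.
have [q xq] := choice approx.
exists (map_mx ratr (\row_i q i)); split; last by exists (\row_i q i).
apply: xe; apply/polyhedral_ballE.
apply: le_lt_trans (polyhedral_norm_le_norm _) _; rewrite mulrC -ltr_pdivlMr//.
have [->|/norm_attained[i ->]] :=
    eqVneq (x - map_mx ratr (\row_i q i) : 'rV_3) 0.
  by rewrite normr0.
by rewrite !mxE xq.
Qed.

(** A hyperplane is closed, so a generating set meets its complement. *)
Lemma generating_dot (K : set (polyhedral_space R)) : generating K ->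
  forall f : 'rV[R]_3, f != 0 -> exists2 y, K y & dot f y != 0.
Proof.
move=> gK f f0; apply: contrapT => nK.
have K0 y : K y -> dot f y = 0.
  by move=> Ky; apply/eqP; apply: contrapT => /negP fy; apply: nK; exists y.
have ff : 0 < dot f f := dot_gt0 f0.
have : closed_linear_span K f by rewrite gK.
pose e := dot f f / (3 * `|f|).
have e0 : 0 < e by rewrite divr_gt0// mulr_gt0// normr_gt0.
move=> /(_ _ (nbhsx_ballx (f : polyhedral_space R) e e0)).
move=> [_ [[m [a [v [Kv ->]]]] /polyhedral_ballE]].
set s := \sum_i _ => h.
have fs : dot f s = 0.
  by rewrite dot_sumr big1// => i _; rewrite dotZr K0 ?mulr0.
have := le_trans (ler_norm _) (dot_le_norm f (f - s)).
rewrite dotBr fs subr0 leNgt => /negP; apply.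
rewrite mulrC -ltr_pdivlMr ?mulr_gt0 ?normr_gt0//.
exact: le_lt_trans (le_polyhedral_norm _) h.
Qed.

Lemma compact_not_full (K : set (polyhedral_space R)) : compact K ->
  exists z, ~ K z.
Proof.
move=> /compact_bounded [M [_ KM]].
have M1 : M < M + 1 by rewrite ltrDl.
exists (vec3 (`|M| + 2) 0 0) => /(KM _ M1); apply/negP.
rewrite -ltNge; apply: lt_le_trans (le_polyhedral_norm _).
apply: lt_le_trans (coord_le_norm _ 0); rewrite mxE/= ger0_norm ?addr_ge0//.
by have := ler_norm M; lra.
Qed.

End PolyhedralSpace.

Theorem theorem2p1 (R : realType) :
  exists (lambda : R) (X : completeNormedModType R),
    1 < lambda /\ separable_space X /\
    forall K : set X, compact K -> convex_set K -> generating K ->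
      ~ exists r : X -> X, retraction_onto K r /\ lambda.-lipschitz r.
Proof.
exists (1 + 1 / 4000), (polyhedral_space R); split; first by lra.
split; first exact: polyhedral_space_separable.
move=> K cK vK gK [r [rK rL]].
have [z Kz] := compact_not_full cK.
have [f [k [x [f1 k01 sf]]]] := spanning_smooth_support vK Kz (generating_dot gK).
have lip y w : N (r y - r w) <= (1 + 1 / 4000) * N (y - w).
  exact: (rL (y, w)).
have l1 : 1 <= 1 + 1 / 4000 :> R by lra.
have eta0 : 0 < 1 / 125 :> R by lra.
have normE (y : 'rV[R]_3) : `|y| <= 1 * N y by rewrite mul1r le_polyhedral_norm.
have [u fu H] := retraction_almost_contractive (@polyhedral_normZ R) normE
  l1 eta0 f1 k01 sf rK lip.
(* The bound on the displacement is [4 * (1 / 4000) * (2 * 125) = 1 / 4], while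
   [dot f u <= 3 * `|f| * `|u|]. *)
have u4 : `|u| <= 1 / 4.
  by apply: le_trans (almost_contractive_small _ f1 H) _; lra.
have := le_trans (ler_norm _) (dot_le_norm f u); rewrite f1; lra.
Qed.
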